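(* Let $\mathbb{K}$ be a field with $\mathrm{char}(\mathbb{K})=0$ and let $\delta\in\mathbb{Z}$. Then: (a) for $r,s\in\mathbb{Z}_{\geq 0}$ not both zero, the walled Brauer algebra $\mathcal{B}_{r,s}(\delta)$ over $\mathbb{K}$ is semisimple if and only if the walled Brauer algebra $\mathcal{B}_{r,s}(\delta)$ over $\mathbb{F}_p$ (with $\delta$ replaced by its image in $\mathbb{F}_p$) is semisimple for infinitely many primes $p$; (b) for $d\in\mathbb{Z}_{>0}$, the Brauer algebra $\mathcal{B}_d(\delta)$ over $\mathbb{K}$ is semisimple if and only if the Brauer algebra $\mathcal{B}_d(\delta)$ over $\mathbb{F}_p$ is semisimple for infinitely many primes $p$.
   Context: For a commutative ring $R$ and $\delta\in R$: the walled Brauer algebra $\mathcal{B}_{r,s}(\delta)$ over $R$ is the free $R$-module with basis the walled Brauer diagrams (Brauer diagrams on $r+s$ top and $r+s$ bottom points with a wall separating the first $r$ from the last $s$ points, such that vertical strands connect points on the same side of the wall and horizontal arcs connect points on opposite sides), with multiplication given by concatenation where each closed loop is replaced by the factor $\delta$; over a field it is equivalently generated by $\sigma_i$ ($i\neq r$) and $u_r$ with the standard walled Brauer relations ($\sigma_i^2=1$, braid relations, $u_r^2=\delta u_r$, $u_r=u_r\sigma_{r\pm1}u_r$, $u_r\sigma_j=\sigma_ju_r$ for $|r-j|>1$, $u_r\sigma_{r-1}\sigma_{r+1}u_r\sigma_{r-1}\sigma_{r+1}=u_r\sigma_{r-1}\sigma_{r+1}u_r=\sigma_{r-1}\sigma_{r+1}u_r\sigma_{r-1}\sigma_{r+1}u_r$).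 The Brauer algebra $\mathcal{B}_d(\delta)$ over $R$ is the free $R$-module with basis all Brauer diagrams (perfect matchings of $d$ top and $d$ bottom points), multiplied by concatenation with closed loops replaced by $\delta$. Both algebras over a field are obtained from the integral versions over $\mathbb{Z}$ by scalar extension. *)

(* Defs.v *)
From HB Require Import structures.
From mathcomp Require Import all_boot all_algebra.
Set Implicit Arguments. Unset Strict Implicit. Unset Printing Implicit Defensive.
Import GRing.Theory.
Local Open Scope ring_scope.

(* A point of a diagram with n top and n bottom points:
   (false, i) = i-th top point, (true, i) = i-th bottom point. *)
Definition pt (n : nat) := (bool * 'I_n)%type.

(* A Brauer diagram = perfect matching on the 2n points, encoded as a
   fixed-point-free involution. *)
Definition is_brauer n (f : {ffun pt n -> pt n}) : bool :=
  [forall x, (f x != x) && (f (f x) == x)].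

Definition bdiag n := {f : {ffun pt n -> pt n} | is_brauer f}.

(* Vertices of the stacked picture d1 over d2:
   (Some false, i) = top row of d1, (None, i) = middle row (bottom of d1 =
   top of d2), (Some true, i) = bottom row of d2. *)
Definition vtx n := (option bool * 'I_n)%type.

Definition emb1 n (x : pt n) : vtx n := (if x.1 then None else Some false, x.2).
Definition emb2 n (x : pt n) : vtx n := (if x.1 then Some true else None, x.2).

Definition stack_rel n (d1 d2 : bdiag n) : rel (vtx n) := fun u v =>
  [exists x, (u == emb1 x) && (v == emb1 (val d1 x))] ||
  [exists x, (u == emb2 x) && (v == emb2 (val d2 x))].

Definition outer n (v : vtx n) : bool := v.1 != None.
Definition of_pt n (x : pt n) : vtx n := (Some x.1, x.2).
Definition to_pt n (v : vtx n) : pt n :=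
  (if v.1 is Some b then b else false, v.2).

Definition comp_fun n (d1 d2 : bdiag n) : {ffun pt n -> pt n} :=
  [ffun x => match [pick w | outer w && (w != of_pt x)
                       && connect (stack_rel d1 d2) (of_pt x) w] with
             | Some w => to_pt w | None => x end].

(* the concatenated diagram (the result is always a Brauer diagram;
   the default d1 is never used) *)
Definition comp n (d1 d2 : bdiag n) : bdiag n := insubd d1 (comp_fun d1 d2).

Definition loops n (d1 d2 : bdiag n) : nat :=
  n_comp (stack_rel d1 d2)
    [pred v : vtx n | (v.1 == None) &&
       ~~ [exists w, outer w && connect (stack_rel d1 d2) v w]].

Definition id_fun n : {ffun pt n -> pt n} := [ffun x => (~~ x.1, x.2)].

Section Alg.
Variables (R : comNzRingType) (n : nat) (delta : R).

Definition bone : {ffun bdiag n -> R} :=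
  [ffun d => if val d == id_fun n then 1 else 0].

Definition bmul (x y : {ffun bdiag n -> R}) : {ffun bdiag n -> R} :=
  [ffun d => \sum_(d1 : bdiag n) \sum_(d2 : bdiag n)
      if comp d1 d2 == d then x d1 * y d2 * delta ^+ loops d1 d2 else 0].

Definition inA (P : pred (bdiag n)) (x : {ffun bdiag n -> R}) : bool :=
  [forall d, (x d != 0) ==> P d].

Definition in_jacobson (P : pred (bdiag n)) (x : {ffun bdiag n -> R}) : Prop :=
  inA P x /\ forall y, inA P y -> exists z, inA P z /\ bmul z (bone - bmul y x) = bone.

(* A finite-dimensional algebra (Artinian) is semisimple iff J = 0. *)
Definition semisimple_diag (P : pred (bdiag n)) : Prop :=
  forall x, in_jacobson P x -> x = 0.
End Alg.

(* walled Brauer diagrams on r+s points: left of the wall = index < r *)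
Definition walled (r s : nat) : pred (bdiag (r + s)) := fun d =>
  [forall x : pt (r + s), let y := val d x in
     if x.1 == y.1 then (x.2 < r)%N != (y.2 < r)%N
     else (x.2 < r)%N == (y.2 < r)%N].

Definition walled_brauer_semisimple (R : comNzRingType) (r s : nat) (delta : R) : Prop :=
  @semisimple_diag R (r + s) delta (@walled r s).

Definition brauer_semisimple (R : comNzRingType) (d : nat) (delta : R) : Prop :=
  @semisimple_diag R d delta predT.

(* Main.v *)
Require Import Defs.
From mathcomp Require Import all_boot all_algebra.
From mathcomp Require Import zify.
Import GRing.Theory.
Local Open Scope ring_scope.
Set Implicit Arguments. Unset Strict Implicit. Unset Printing Implicit Defensive.

(** Let [A] be the integral algebra spanned by a set of diagrams closed under
    concatenation, acting on the whole Brauer algebra by right multiplication. Over a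
    field in which the rank [N] of the latter and all smaller positive integers are
    invertible, the Jacobson radical of [A] is the radical of the trace form
    [(x, y) |-> tr (x y)]. Indeed the Jacobson radical is nil, and nilpotent matrices
    have trace zero; conversely, if [a] generates a left ideal on which the trace
    vanishes, Fitting's lemma produces an idempotent [e] in [F[a] a], whose trace is its
    rank, so [e = 0] and [a] is nilpotent. Hence [A] is semisimple over such a field iff
    the determinant of the integral Gram matrix of the trace form is nonzero there. A
    nonzero integer is nonzero modulo all large primes, and an integer which is nonzero
    modulo some prime is nonzero.

    Associativity of concatenation, together with the additivity of the number of
    loops, follows from the faithful action of diagrams on tensor powers of a
    2-dimensional space: a diagram is determined by the labelings of its points that
    are constant along its strands, and a concatenation with [l] loops has [2 ^ l]
    labelings extending a compatible labeling of the outer points. The closure of walled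
    diagrams under concatenation is read off the same labelings. *)

(** * Concatenation of diagrams *)

Lemma iter_injective (T : Type) (f : T -> T) (k : nat) :
  injective f -> injective (iter k f).
Proof. by move=> injf; elim: k => [|k IH] x y //= /injf/IH. Qed.

Lemma dvdn_order_iter (V : finType) (f : V -> V) (x : V) (k : nat) :
  injective f -> (iter k f x == x) = (order f x %| k)%N.
Proof.
move=> injf; have xE q : iter (q * order f x) f x = x.
  by elim: q => // q IH; rewrite mulSn addnC iterD iter_order // IH.
rewrite {1}(divn_eq k (order f x)) addnC iterD xE.
have lt_r : (k %% order f x < order f x)%N by rewrite ltn_mod order_gt0.
apply/eqP/idP => [/(congr1 (findex f x))|/eqP->] //.
by rewrite findex_iter // findex0 => r0; rewrite /dvdn r0.
Qed.

(** * Orbits of a product of two involutions *)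

Section TwoInvolutions.
Variables (V : finType) (a b : V -> V).
Hypotheses (aK : involutive a) (bK : involutive b).
Let c (v : V) := b (a v).
Variable x : V.
Hypothesis bx : b x = x.

Let c_inj : injective c.
Proof. by move=> u v /(inv_inj bK)/(inv_inj aK). Qed.

(** Conjugation by [b] inverts [c], and [b] fixes [x]; hence [b] sends the [k]-th iterate of [x]
    under [c] to the [(-k)]-th one. *)
Let iter_c_b k : iter k c (b (iter k c x)) = x.
Proof.
elim: k => [|k IH] //=; rewrite -iterS iterSr /c bK aK.
by have := IH; rewrite /c.
Qed.

Lemma orbit_b_stable y : fconnect c x y -> fconnect c x (b y).
Proof.
move=> xy; rewrite (fconnect_sym c_inj) -(iter_findex xy).
by set k := findex c x y; have := fconnect_iter c k (b (iter k c x)); rewrite iter_c_b.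
Qed.

Lemma orbit_a_stable y : fconnect c x y -> fconnect c x (a y).
Proof.
move=> xy; rewrite -[a y]bK; apply: orbit_b_stable.
exact: connect_trans xy (fconnect1 c y).
Qed.

Lemma orbit_fix_b k : (b (iter k c x) == iter k c x) = (order c x %| k.*2)%N.
Proof.
rewrite -(dvdn_order_iter _ _ c_inj) -addnn iterD.
rewrite -(inj_eq (@iter_injective _ _ k c_inj)) iter_c_b; exact: eq_sym.
Qed.

(** Since [a] is [b] after [c], it sends the [k]-th iterate to the [(-(k+1))]-th one, so the two
    agree iff the orbit length divides [2k+1]. *)
Lemma orbit_fix_a k : (a (iter k c x) == iter k c x) = (order c x %| k.*2.+1)%N.
Proof.
rewrite -(dvdn_order_iter _ _ c_inj) -addnn -addSn iterD.
rewrite -(inj_eq (@iter_injective _ _ k.+1 c_inj)) -{1}[a _]bK -/(c _) -iterS iter_c_b.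
exact: eq_sym.
Qed.

(* An orbit through a fixed point of [b] is a path, whose other end is the only
   other point of the orbit fixed by [a] or [b]. *)
Lemma orbit_other_end : a x != x ->
  exists y, [/\ y != x, fconnect c x y, (a y == y) || (b y == y) &
    forall z, fconnect c x z -> (a z == z) || (b z == z) -> z = x \/ z = y].
Proof.
move=> ax; have := orbit_fix_a 0; rewrite /= (negbTE ax) => m1.
have m0 := order_gt0 c x; set m := order c x in m0 m1 *.
have m2 : (1 < m)%N by case: m m0 m1 => [|[|]].
have hm : (m./2 < m)%N by lia.
(* For [0 < k < m] both [2k] and [2k+1] lie strictly between 0 and [2m], so the one divisible by [m]
   equals [m]; either way [k = m./2]. *)
exists (iter m./2 c x); split.
- apply/eqP => /(congr1 (findex c x)); rewrite findex_iter // findex0; lia.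
- exact: fconnect_iter.
- rewrite orbit_fix_a orbit_fix_b -/m -[X in (X %| _)%N || (X %| _)%N]odd_double_half.
  by case: (odd m); rewrite ?add0n ?add1n dvdnn ?orbT.
move=> z xz; rewrite -(iter_findex xz) orbit_fix_a orbit_fix_b -/m.
have := findex_max xz; rewrite -/m; set k := findex c x z => km.
have [-> _|k0] := posnP k; first by left.
move=> dv; right; congr (iter _ c x).
have [/dvdnP[q Eq]|/dvdnP[q Eq]] := orP dv;
  have : (q = 1)%N by [case: q Eq => [|[|q]] //; nia].
  by move=> q1; lia.
by move=> q1; lia.
Qed.

End TwoInvolutions.

(** * Strands of a stacked pair of diagrams *)

Section Concatenation.
Variable n : nat.
Implicit Types (d : bdiag n).

Lemma bdiag_neq d x : val d x != x.
Proof. by have /forallP/(_ x)/andP[] := valP d. Qed.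

Lemma bdiagK d : involutive (val d).
Proof. by move=> x; have /forallP/(_ x)/andP[_ /eqP] := valP d. Qed.

Lemma emb1_inj : injective (@emb1 n).
Proof. by move=> [[] i] [[] j] [] // ->. Qed.

Lemma emb2_inj : injective (@emb2 n).
Proof. by move=> [[] i] [[] j] [] // ->. Qed.

(** Each matching is extended by the identity to the row it does not touch. The stacked picture
    becomes the graph of two involutions on one vertex set, whose fixed points are exactly the outer
    vertices. *)
Definition upper_swap d (v : vtx n) : vtx n :=
  match v.1 with
  | Some true => v
  | Some false => emb1 (val d (false, v.2))
  | None => emb1 (val d (true, v.2))
  end.

Definition lower_swap d (v : vtx n) : vtx n :=
  match v.1 with
  | Some true => emb2 (val d (true, v.2))
  | Some false => v
  | None => emb2 (val d (false, v.2))
  end.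

Lemma upper_swap_emb d x : upper_swap d (emb1 x) = emb1 (val d x).
Proof. by case: x => [[] i]. Qed.

Lemma lower_swap_emb d x : lower_swap d (emb2 x) = emb2 (val d x).
Proof. by case: x => [[] i]. Qed.

Lemma upper_vtxP (v : vtx n) : v.1 = Some true \/ exists x, v = emb1 x.
Proof.
by case: v => [[[]|] i]; [left|right; exists (false, i)|right; exists (true, i)].
Qed.

Lemma lower_vtxP (v : vtx n) : v.1 = Some false \/ exists x, v = emb2 x.
Proof.
by case: v => [[[]|] i]; [right; exists (true, i)|left|right; exists (false, i)].
Qed.

Lemma upper_swapK d : involutive (upper_swap d).
Proof.
move=> v; case: (upper_vtxP v) => [v1|[x ->]]; first by rewrite /upper_swap !v1.
by rewrite !upper_swap_emb bdiagK.
Qed.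

Lemma lower_swapK d : involutive (lower_swap d).
Proof.
move=> v; case: (lower_vtxP v) => [v1|[x ->]]; first by rewrite /lower_swap !v1.
by rewrite !lower_swap_emb bdiagK.
Qed.

Lemma upper_swap_fix d v : (upper_swap d v == v) = (v.1 == Some true).
Proof.
case: (upper_vtxP v) => [v1|[x ->]]; first by rewrite /upper_swap !v1 !eqxx.
by rewrite upper_swap_emb (inj_eq emb1_inj) (negbTE (bdiag_neq d x)); case: x => [[] i].
Qed.

Lemma lower_swap_fix d v : (lower_swap d v == v) = (v.1 == Some false).
Proof.
case: (lower_vtxP v) => [v1|[x ->]]; first by rewrite /lower_swap !v1 !eqxx.
by rewrite lower_swap_emb (inj_eq emb2_inj) (negbTE (bdiag_neq d x)); case: x => [[] i].
Qed.

Lemma swap_fix_outer d1 d2 v :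
  (upper_swap d1 v == v) || (lower_swap d2 v == v) = outer v.
Proof. by rewrite upper_swap_fix lower_swap_fix; case: v => [[[]|] i]. Qed.

Lemma stack_relP d1 d2 u v :
  reflect ((exists2 x, u = emb1 x & v = emb1 (val d1 x)) \/
           (exists2 x, u = emb2 x & v = emb2 (val d2 x))) (stack_rel d1 d2 u v).
Proof.
apply: (iffP orP) => [[/existsP[x /andP[/eqP ? /eqP ?]]|/existsP[x /andP[/eqP ? /eqP ?]]]|].
- by left; exists x.
- by right; exists x.
by case=> -[x -> ->]; [left|right]; apply/existsP; exists x; rewrite !eqxx.
Qed.

Lemma stack_sym d1 d2 : connect_sym (stack_rel d1 d2).
Proof.
have sub u v : stack_rel d1 d2 u v -> stack_rel d1 d2 v u.
  by case/stack_relP=> -[x -> ->]; apply/stack_relP; [left|right];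
    [exists (val d1 x)|exists (val d2 x)]; rewrite ?bdiagK.
by apply: sym_connect_sym => u v; apply/idP/idP; apply: sub.
Qed.

Lemma connect_upper d1 d2 v : connect (stack_rel d1 d2) v (upper_swap d1 v).
Proof.
case: (upper_vtxP v) => [v1|[x ->]]; first by rewrite /upper_swap !v1.
by rewrite upper_swap_emb connect1 //; apply/stack_relP; left; exists x.
Qed.

Lemma connect_lower d1 d2 v : connect (stack_rel d1 d2) v (lower_swap d2 v).
Proof.
case: (lower_vtxP v) => [v1|[x ->]]; first by rewrite /lower_swap !v1.
by rewrite lower_swap_emb connect1 //; apply/stack_relP; right; exists x.
Qed.

Lemma connect_stack_orbit d1 d2 (f : vtx n -> vtx n) (x : vtx n) :
    (forall v, connect (stack_rel d1 d2) v (f v)) ->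
    (forall v, fconnect f x v -> fconnect f x (upper_swap d1 v)) ->
    (forall v, fconnect f x v -> fconnect f x (lower_swap d2 v)) ->
  connect (stack_rel d1 d2) x =1 fconnect f x.
Proof.
move=> ef su sl y; apply/idP/idP.
  case/connectP=> p; elim/last_ind: p y => [|p z IH] y; first by move=> _ ->.
  rewrite rcons_path last_rcons => /andP[/IH/(_ erefl)]; set v := last x p.
  move=> xv evz ->; case/stack_relP: evz => -[w vE ->].
    by rewrite -upper_swap_emb -vE su.
  by rewrite -lower_swap_emb -vE sl.
by apply: connect_sub => u v /eqP<-.
Qed.

Lemma other_endP d1 d2 x : outer x ->
  exists y, [/\ y != x, outer y, connect (stack_rel d1 d2) x y &
    forall z, outer z -> connect (stack_rel d1 d2) x z -> z = x \/ z = y].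
Proof.
move=> ox; have cu := @connect_upper d1 d2; have cl := @connect_lower d1 d2.
(* The swap that fixes [x] depends on its row; that swap plays the role of [b] in
   [orbit_other_end]. *)
have [xt|xb] : x.1 = Some false \/ x.1 = Some true by case: x ox => [[[]|] i]; auto.
- have bx : lower_swap d2 x = x by apply/eqP; rewrite lower_swap_fix xt.
  have ax : upper_swap d1 x != x by rewrite upper_swap_fix xt.
  have cE := connect_stack_orbit (fun v => connect_trans (cu v) (cl _))
     (@orbit_a_stable _ _ _ (@upper_swapK d1) (@lower_swapK d2) x bx)
     (@orbit_b_stable _ _ _ (@upper_swapK d1) (@lower_swapK d2) x bx).
  have [y [yx xy yfix yP]] := orbit_other_end (@upper_swapK d1) (@lower_swapK d2) bx ax.
  exists y; split; rewrite ?cE //; first by rewrite -(swap_fix_outer d1 d2).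
  by move=> z oz; rewrite cE => xz; apply: yP; rewrite // swap_fix_outer.
- have bx : upper_swap d1 x = x by apply/eqP; rewrite upper_swap_fix xb.
  have ax : lower_swap d2 x != x by rewrite lower_swap_fix xb.
  have cE := connect_stack_orbit (fun v => connect_trans (cl v) (cu _))
     (@orbit_b_stable _ _ _ (@lower_swapK d2) (@upper_swapK d1) x bx)
     (@orbit_a_stable _ _ _ (@lower_swapK d2) (@upper_swapK d1) x bx).
  have [y [yx xy yfix yP]] := orbit_other_end (@lower_swapK d2) (@upper_swapK d1) bx ax.
  exists y; split; rewrite ?cE //; first by rewrite -(swap_fix_outer d1 d2) orbC.
  by move=> z oz; rewrite cE => xz; apply: yP; rewrite // orbC swap_fix_outer.
Qed.

Lemma of_ptK : cancel (@of_pt n) (@to_pt n).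
Proof. by case. Qed.

Lemma to_ptK (v : vtx n) : outer v -> of_pt (to_pt v) = v.
Proof. by case: v => [[]]. Qed.

Lemma outer_of_pt (x : pt n) : outer (of_pt x).
Proof. by []. Qed.

Lemma of_pt_inj : injective (@of_pt n).
Proof. exact: can_inj of_ptK. Qed.

Lemma comp_fun_spec d1 d2 x :
  let y := comp_fun d1 d2 x in
  [/\ y != x, connect (stack_rel d1 d2) (of_pt x) (of_pt y) &
   forall z, connect (stack_rel d1 d2) (of_pt x) (of_pt z) -> z = x \/ z = y].
Proof.
rewrite /comp_fun ffunE; have [y [yx oy xy yP]] := other_endP d1 d2 (outer_of_pt x).
case: pickP => [w /andP[/andP[ow wx] xw]|/(_ y)]; last by rewrite oy yx xy.
have wy : w = y by case: (yP w ow xw) => // wE; rewrite wE eqxx in wx.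
rewrite -wy in yx xy yP; rewrite to_ptK //; split=> //.
- by rewrite -(inj_eq of_pt_inj) to_ptK.
- by move=> z /(yP _ (outer_of_pt z))[/of_pt_inj->|<-]; [left|right; rewrite of_ptK].
Qed.

Lemma comp_fun_brauer d1 d2 : is_brauer (comp_fun d1 d2).
Proof.
apply/forallP => x; have [yx xy yP] := comp_fun_spec d1 d2 x; rewrite yx /=.
have [zy yz zP] := comp_fun_spec d1 d2 (comp_fun d1 d2 x).
have [//||xE] := zP x; first by rewrite stack_sym.
  by move=> xE; rewrite -xE eqxx in yx.
by rewrite -xE.
Qed.

Lemma val_comp d1 d2 : val (Defs.comp d1 d2) = comp_fun d1 d2.
Proof. by rewrite insubdK //; apply: comp_fun_brauer. Qed.

(** * Labelings of the points and the tensor representation *)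

Definition labeling := {ffun 'I_n -> bool}.

Definition glue (i j : labeling) (x : pt n) : bool := if x.1 then j x.2 else i x.2.

Definition compat d (f : pt n -> bool) : bool := [forall x, f (val d x) == f x].

Lemma compatP d f : reflect (forall x, f (val d x) = f x) (compat d f).
Proof. by apply: (iffP forallP) => h x; apply/eqP. Qed.

Lemma glue_surj (f : pt n -> bool) : exists i j, f =1 glue i j.
Proof.
exists [ffun k => f (false, k)], [ffun k => f (true, k)].
by case=> [[] k]; rewrite /glue /= ffunE.
Qed.

Definition glue3 (i k j : labeling) (v : vtx n) : bool :=
  match v.1 with Some false => i v.2 | None => k v.2 | Some true => j v.2 end.

Lemma glue3_emb1 i k j x : glue3 i k j (emb1 x) = glue i k x.
Proof. by case: x => [[] u]. Qed.

Lemma glue3_emb2 i k j x : glue3 i k j (emb2 x) = glue k j x.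
Proof. by case: x => [[] u]. Qed.

Lemma glue3_of_pt i k j x : glue3 i k j (of_pt x) = glue i j x.
Proof. by case: x => [[] u]. Qed.

Lemma compat_stackP d1 d2 i k j :
  reflect (forall u v, connect (stack_rel d1 d2) u v -> glue3 i k j u = glue3 i k j v)
    (compat d1 (glue i k) && compat d2 (glue k j)).
Proof.
apply: (iffP andP) => [[/compatP c1 /compatP c2] u v|h].
  case/connectP=> p; elim/last_ind: p v => [|p z IH] v; first by move=> _ ->.
  rewrite rcons_path last_rcons => /andP[/IH/(_ erefl)-> evz] ->.
  by case/stack_relP: evz => -[w -> ->]; rewrite ?glue3_emb1 ?glue3_emb2 ?c1 ?c2.
split; apply/compatP => x.
  by rewrite -!(glue3_emb1 i k j) (h (emb1 x) (emb1 (val d1 x))) //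
    connect1 //; apply/stack_relP; left; exists x.
by rewrite -!(glue3_emb2 i k j) (h (emb2 x) (emb2 (val d2 x))) //
  connect1 //; apply/stack_relP; right; exists x.
Qed.

Lemma compat_stack_comp d1 d2 i k j :
  compat d1 (glue i k) -> compat d2 (glue k j) -> compat (Defs.comp d1 d2) (glue i j).
Proof.
move=> c1 c2; have /compat_stackP h : compat d1 (glue i k) && compat d2 (glue k j).
  by rewrite c1 c2.
apply/compatP => x; rewrite val_comp; have [_ xy _] := comp_fun_spec d1 d2 x.
by rewrite -!(glue3_of_pt i k j) (h _ _ xy).
Qed.

Section CountLabelings.
Variables (d1 d2 : bdiag n) (i j : labeling).
Let e := stack_rel d1 d2.
Let loop_vtx : pred (vtx n) := fun v =>
  (v.1 == None) && ~~ [exists w, outer w && connect e v w].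
Let loop_root : pred (vtx n) := fun v => fingraph.roots e v && loop_vtx v.

Lemma loops_card : loops d1 d2 = #|loop_root|.
Proof. by apply: eq_card => v; rewrite !inE. Qed.

Let middle := [set k : labeling | compat d1 (glue i k) && compat d2 (glue k j)].

(** A compatible middle row is forced on components that reach an outer vertex and free on each
    loop. The free choices are recorded at one root per loop, which gives the count [2 ^ loops]. *)
Let loop_labels (k : labeling) : {ffun vtx n -> bool} :=
  [ffun v => loop_root v && k v.2].

Let not_outer_none (v : vtx n) : ~~ outer v -> v.1 = None.
Proof. by rewrite negbK => /eqP. Qed.

Let root_loop v : loop_vtx v -> loop_root (fingraph.root e v).
Proof.
case/andP=> _ /existsPn nv.
have vr : connect e v (fingraph.root e v) by exact: connect_root.
rewrite /loop_root roots_root //=; last exact: stack_sym.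
rewrite /loop_vtx; apply/andP; split.
  apply/eqP/not_outer_none; apply/negP => root_outer.
  by have := nv (fingraph.root e v); rewrite root_outer vr.
apply/existsPn => w; apply: contra (nv w) => /andP[-> rw].
by rewrite (connect_trans vr rw).
Qed.

Let loop_labels_inj : {in middle &, injective loop_labels}.
Proof.
move=> k k'; rewrite !inE => /compat_stackP h /compat_stackP h' /ffunP kk'.
apply/ffunP => u; rewrite -[k u]/(glue3 i k j (None, u)) -[k' u]/(glue3 i k' j (None, u)).
have [lv|] := boolP (loop_vtx (None, u)).
  have vr : connect e (None, u) (fingraph.root e (None, u)) by exact: connect_root.
  rewrite (h _ _ vr) (h' _ _ vr).
  have := root_loop lv; set r := fingraph.root _ _ => lr; have := kk' r.
  rewrite !ffunE lr /= /glue3; have /andP[_ /andP[/eqP-> _]] := lr; exact.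
rewrite negb_and negbK /= => /existsP[w /andP[ow vw]].
by rewrite (h _ _ vw) (h' _ _ vw) -(to_ptK ow) !glue3_of_pt.
Qed.

Let loop_labels_surj (g : {ffun vtx n -> bool}) : compat (Defs.comp d1 d2) (glue i j) ->
  g \in pffun_on false loop_root predT -> exists2 k, k \in middle & g = loop_labels k.
Proof.
move=> /compatP cf /pffun_onP[/supportP supp _].
(* The label comes from an outer vertex of the component if there is one, and otherwise from [g] at
   the root of the loop; both are constant on components. *)
pose H v := if [pick w | outer w && connect e v w] is Some w then glue i j (to_pt w)
            else g (fingraph.root e v).
have H_conn u v : connect e u v -> H u = H v.
  move=> uv; rewrite /H (@eq_pick _ _ [pred w | outer w && connect e v w]).
    by case: pickP => // _; rewrite (fingraph.rootP (stack_sym d1 d2) uv).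
  by move=> w /=; rewrite (same_connect (stack_sym d1 d2) uv).
have H_of_pt x : H (of_pt x) = glue i j x.
  rewrite /H; case: pickP => [w /andP[ow xw]|/(_ (of_pt x))]; last by rewrite /= connect0.
  (* The picked outer vertex is [x] or its partner in the composite, and these carry the same label
     by [cf]. *)
  have [_ _ yP] := comp_fun_spec d1 d2 x.
  rewrite -(to_ptK ow) in xw; case: (yP _ xw) => ->; rewrite // -val_comp; exact: cf.
pose k : labeling := [ffun u => H (None, u)].
have gE v : glue3 i k j v = H v.
  case: v => [[b|] u]; last by rewrite /glue3 /= ffunE.
  by rewrite -[(Some b, u)]/(of_pt (b, u)) H_of_pt glue3_of_pt.
exists k; first by rewrite inE; apply/compat_stackP => u v uv; rewrite !gE (H_conn _ _ uv).
apply/ffunP => v; rewrite ffunE; have [lv|/supp-> //] := boolP (loop_root v).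
have /andP[/eqP rv /andP[/eqP v1 /existsPn nv]] := lv.
rewrite /= ffunE -v1 -surjective_pairing /H rv.
by case: pickP => // w; rewrite (negbTE (nv w)).
Qed.

Lemma card_middle_labelings :
  #|[set k | compat d1 (glue i k) && compat d2 (glue k j)]| =
    (compat (Defs.comp d1 d2) (glue i j) * 2 ^ loops d1 d2)%N.
Proof.
have [cf|ncf] := boolP (compat (Defs.comp d1 d2) (glue i j)); last first.
  apply/eqP; rewrite cards_eq0 -subset0; apply/subsetP => k; rewrite !inE => /andP[c1 c2].
  by rewrite (compat_stack_comp c1 c2) in ncf.
rewrite mul1n loops_card -card_bool -(card_pffun_on false loop_root predT).
rewrite -(card_in_imset loop_labels_inj); apply: eq_card => g; apply/imsetP/idP; last first.
  exact: loop_labels_surj.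
case=> k _ ->; apply/pffun_onP; split => //.
by apply/supportP => v; rewrite ffunE -[v \notin _]/(~~ loop_root v) => /negbTE->.
Qed.

End CountLabelings.

Lemma compat_strand d x : compat d (fun y => (y == x) || (y == val d x)).
Proof.
apply/compatP => y; rewrite orbC (inj_eq (can_inj (bdiagK d))).
by rewrite -{2}[x](bdiagK d) (inj_eq (can_inj (bdiagK d))).
Qed.

(** The indicator of a single strand of [d] is compatible with [d'] only if [d'] has that strand
    too. *)
Lemma compat_inj d d' : (forall f, compat d f -> compat d' f) -> d = d'.
Proof.
move=> h; apply/val_inj/ffunP => x; have /compatP/(_ x) := h _ (compat_strand d x).
by rewrite eqxx /= (negbTE (bdiag_neq _ _)) => /eqP->.
Qed.

Lemma compat_glue_inj d d' :
  (forall i j, compat d (glue i j) -> compat d' (glue i j)) -> d = d'.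
Proof.
move=> h; apply: compat_inj => f /compatP cf; have [i [j fE]] := glue_surj f.
have /compatP cf' : compat d' (glue i j).
  by apply: h; apply/compatP => x; rewrite -!fE.
by apply/compatP => x; rewrite !fE.
Qed.

(* [d] acts on the tensor power of a 2-dimensional space by the matrix
   [compat d (glue i j)], and loops count for a factor 2. *)
Lemma sum_compat d1 d2 i j :
  (\sum_(k : labeling) compat d1 (glue i k) * compat d2 (glue k j) =
    compat (Defs.comp d1 d2) (glue i j) * 2 ^ loops d1 d2)%N.
Proof.
rewrite -card_middle_labelings cardsE -sum1_card [RHS]big_mkcond.
by apply: eq_bigr => k _; rewrite mulnb unfold_in; case: (_ && _).
Qed.

(** The supports of the two matrices determine the diagrams. The constant labeling, compatible with
    every diagram, determines the exponents. *)
Lemma compat_scale_inj d d' p q :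
    (forall i j, compat d (glue i j) * 2 ^ p = compat d' (glue i j) * 2 ^ q)%N ->
  d = d' /\ p = q.
Proof.
move=> h; split.
  apply: compat_glue_inj => i j cf; have := h i j; rewrite cf mul1n.
  by case: compat => // /eqP; rewrite mul0n expn_eq0.
have cst : glue [ffun=> false] [ffun=> false] =1 (fun=> false).
  by case=> [[] u]; rewrite /glue /= ffunE.
have ccst d0 : compat d0 (glue [ffun=> false] [ffun=> false]).
  by apply/compatP => x; rewrite !cst.
have /eqP := h [ffun=> false] [ffun=> false].
by rewrite !ccst !mul1n eqn_exp2l // => /eqP.
Qed.

(** Both sides expand to the same double sum over labelings of the two intermediate rows, by
    associativity of matrix multiplication. *)
Lemma comp_loops_assoc d1 d2 d3 :
  Defs.comp (Defs.comp d1 d2) d3 = Defs.comp d1 (Defs.comp d2 d3) /\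
  (loops (Defs.comp d1 d2) d3 + loops d1 d2 = loops d1 (Defs.comp d2 d3) + loops d2 d3)%N.
Proof.
apply: compat_scale_inj => i j; rewrite !expnD !mulnA -!sum_compat !big_distrl /=.
under eq_bigr => k _ do rewrite mulnAC -sum_compat big_distrl /=.
rewrite exchange_big; apply: eq_bigr => k _.
rewrite -mulnA -sum_compat big_distrr /=; apply: eq_bigr => l _.
by rewrite mulnA.
Qed.

Lemma id_fun_brauer : is_brauer (id_fun n).
Proof.
apply/forallP => -[b u]; rewrite !ffunE /= negbK eqxx andbT.
by rewrite xpair_eqE negb_and; case: b.
Qed.

Definition id_diag : bdiag n := Sub (id_fun n) id_fun_brauer.

Lemma compat_id i j : compat id_diag (glue i j) = (i == j).
Proof.
apply/compatP/eqP => [h|->]; last by case=> [[] u]; rewrite ffunE.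
by apply/ffunP => u; have := h (true, u); rewrite ffunE.
Qed.

Lemma comp_loops_1l d : Defs.comp id_diag d = d /\ loops id_diag d = 0%N.
Proof.
apply: compat_scale_inj => i j; rewrite -sum_compat muln1.
rewrite (bigD1 i) //= compat_id eqxx mul1n big1 ?addn0 // => k ki.
by rewrite compat_id eq_sym (negbTE ki).
Qed.

Lemma comp_loops_1r d : Defs.comp d id_diag = d /\ loops d id_diag = 0%N.
Proof.
apply: compat_scale_inj => i j; rewrite -sum_compat muln1.
rewrite (bigD1 j) //= compat_id eqxx muln1 big1 ?addn0 // => k kj.
by rewrite compat_id (negbTE kj) muln0.
Qed.

End Concatenation.

(** * Walled diagrams *)

Section Walled.
Variables r s : nat.
Implicit Types (d : bdiag (r + s)) (x : pt (r + s)) (i j : labeling (r + s)).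

(* Orientation of the strands: left of the wall they run downwards, right of it
   upwards, so that a diagram is walled iff each strand joins a source to a sink. *)
Definition source x : bool := x.1 (+) (x.2 < r)%N.

Lemma walled_source d : walled d = [forall x, source (val d x) == ~~ source x].
Proof.
apply: eq_forallb => x; rewrite /source; case: x => b u; case: (val d (b, u)) => c v /=.
by case: b; case: c; case: (u < r)%N; case: (v < r)%N.
Qed.

(** This is a torus weight on mixed tensor space, the factors left of the wall being dualized. *)
Definition weight i : int := \sum_(u < r + s) (-1) ^+ (u < r)%N * (i u)%:R.

Lemma sum_source i j :
  \sum_x (-1) ^+ source x * (glue i j x)%:R = weight i - weight j :> int.
Proof.
rewrite -(pair_bigA _ (fun b u => (-1) ^+ source (b, u) * (glue i j (b, u))%:R)).
rewrite big_bool /= addrC; congr (_ + _); rewrite /weight.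
rewrite -sumrN; apply: eq_bigr => u _; rewrite /source /glue /=.
by case: (u < r)%N; rewrite ?expr1 ?expr0 ?mulN1r ?mul1r ?opprK.
Qed.

(** In a walled diagram the two ends of a strand have equal labels and opposite signs, so the signed
    sum of [sum_source] equals its own negative. Conversely, the indicator of one strand leaves only
    the signs of its two ends, which must cancel. *)
Lemma walled_weightP d :
  reflect (forall i j, compat d (glue i j) -> weight i = weight j) (walled d).
Proof.
rewrite walled_source; apply: (iffP forallP) => [wd i j /compatP cf|h x].
  apply/eqP; rewrite -subr_eq0 -sum_source; set S := (X in X == _).
  suff : S = - S by lia.
  rewrite /S {1}(reindex_inj (can_inj (bdiagK d))) -sumrN; apply: eq_bigr => x _.
  by rewrite cf (eqP (wd x)) signrN mulNr.
pose f y := (y == x) || (y == val d x); have [i [j fE]] := glue_surj f.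
have /h/eqP : compat d (glue i j).
  by apply/compatP => y; rewrite -!fE; exact/compatP/compat_strand.
have dx := bdiag_neq d x.
rewrite -subr_eq0 -sum_source (bigD1 x) //= (bigD1 (val d x)) //= big1 => [|y].
  by rewrite -!fE /f !eqxx orbT !mulr1 addr0; case: source; case: source.
by case/andP=> yx ydx; rewrite -fE /f (negbTE yx) (negbTE ydx) mulr0.
Qed.

(** A labeling compatible with the composite extends to the middle row, the number of extensions
    being a power of 2; the weight is then preserved through each layer. *)
Lemma walled_comp d1 d2 : walled d1 -> walled d2 -> @walled r s (Defs.comp d1 d2).
Proof.
move=> /walled_weightP w1 /walled_weightP w2; apply/walled_weightP => i j cf.
have : (0 < #|[set k | compat d1 (glue i k) && compat d2 (glue k j)]|)%N.
  by rewrite card_middle_labelings cf mul1n expn_gt0.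
case/card_gt0P=> k; rewrite inE => /andP[/w1-> /w2->] //.
Qed.

Lemma walled_id : @walled r s (id_diag (r + s)).
Proof. by apply/walled_weightP => i j; rewrite compat_id => /eqP->. Qed.

End Walled.

(** * The trace form and the Jacobson radical *)

Section MatrixAlgebra.
Variable F : fieldType.

Lemma rank_factorization m n (A : 'M[F]_(m, n)) :
  exists (C : 'M_(m, \rank A)) (B : 'M_(\rank A, n)) C' B',
    [/\ A = C *m B, C' *m C = 1%:M & B *m B' = 1%:M].
Proof.
have /row_fullP[C' C'C] := col_base_full A; have /row_freeP[B' BB'] := row_base_free A.
by exists (col_base A), (row_base A), C', B'; rewrite mulmx_base.
Qed.

(** With a full-rank factorization [A = C *m B], the matrix [B *m C] has the same trace and a
    nilpotency exponent lower by one; its size may change, so the induction quantifies over [n]. *)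
Lemma mxtrace_nilpotent n (A : 'M[F]_n) m : A ^+ m = 0 -> \tr A = 0.
Proof.
elim: m n A => [|m IH] n A Am0.
  by rewrite -[A]mulr1 -(expr0 A) Am0 mulr0 mxtrace0.
have [C [B [C' [B' [AE C'C BB']]]]] := rank_factorization A.
have powE k : A ^+ k.+1 = C *m (B *m C) ^+ k *m B.
  elim: k => [|k IHk]; first by rewrite expr1 expr0 mulmx1.
  by rewrite exprS IHk [in RHS]exprS {1}AE -!mulmxE !mulmxA.
rewrite [in LHS]AE mxtrace_mulC; apply: IH.
move: Am0; rewrite powE => /(congr1 (fun X => C' *m X *m B')).
by rewrite !mulmxA C'C mul1mx -mulmxA BB' mulmx1 mulmx0 mul0mx.
Qed.

Lemma mxtrace_idempotent n (A : 'M[F]_n) : A *m A = A -> \tr A = (\rank A)%:R.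
Proof.
have [C [B [C' [B' [AE C'C BB']]]]] := rank_factorization A => AA.
have BC1 : B *m C = 1%:M.
  move: AA; rewrite {1 2 3}AE => /(congr1 (fun X => C' *m X *m B')).
  by rewrite !mulmxA C'C !mul1mx -!mulmxA BB' mulmx1.
by rewrite [in LHS]AE mxtrace_mulC BC1 mxtrace1.
Qed.

(** The characteristic polynomial is [q * 'X^m] with [q.[0]] nonzero. Cayley-Hamilton, divided by
    [q.[0]], writes [a ^+ m] as a multiple of [a ^+ m.+1]. *)
Lemma fitting n (a : 'M[F]_n.+1) :
  exists m g, a ^+ m.+1 = horner_mx a g * a ^+ m.+2.
Proof.
have [m [q]] := multiplicity_XsubC (char_poly a) 0.
rewrite monic_neq0 ?char_poly_monic //= polyC0 subr0 => q0 cE.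
have [h hE] : exists h, q = h * 'X + q.[0]%:P.
  have /factor_theorem[h hE] : root (q - q.[0]%:P) 0 by rewrite /root !hornerE subrr.
  by exists h; apply/eqP; rewrite -subr_eq hE polyC0 subr0.
have := Cayley_Hamilton a; rewrite cE hE.
rewrite rmorphM rmorphXn rmorphD rmorphM /= horner_mx_X horner_mx_C => E.
exists m, (- q.[0]^-1 *: h).
have : q.[0] *: a ^+ m = - (horner_mx a h * a ^+ m.+1).
  apply/eqP; rewrite -addr_eq0; apply/eqP; rewrite -[RHS]E mulrDl addrC.
  by rewrite exprS mulrA -!mulmxE mul_scalar_mx.
(* The extra factor [a] makes the exponent positive, so that the power of [a] in the later
   idempotent ends in a factor [a]. *)
move/(congr1 (fun X => q.[0]^-1 *: (X * a))); rewrite -scalerAl scalerA mulVf //.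
rewrite scale1r -exprSr => ->; rewrite linearZ /= mulNr -mulrA -exprSr scalerN -scaleNr.
by rewrite scalerAl.
Qed.

Section Radical.
Variables (n : nat) (S : 'M[F]_n.+1 -> Prop).
Hypotheses (S1 : S 1) (SD : forall x y, S x -> S y -> S (x + y))
  (SZ : forall c x, S x -> S (c *: x)) (SM : forall x y, S x -> S y -> S (x * y)).

Lemma subalgebra_horner a p : S a -> S (horner_mx a p).
Proof.
move=> Sa; elim/poly_ind: p => [|p c IH]; first by rewrite rmorph0 -(scale0r 1); apply: SZ.
rewrite rmorphD rmorphM /= horner_mx_X horner_mx_C; apply: SD; first exact: SM.
by rewrite -scalemx1; apply: SZ.
Qed.

Lemma subalgebra_exp a k : S a -> S (a ^+ k).
Proof. by move=> Sa; elim: k => [|k IH]; rewrite ?expr0 // exprS; apply: SM. Qed.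

(* In a finite-dimensional algebra the Jacobson radical is nil. *)
Lemma jacobson_trace x : S x ->
    (forall y, S y -> exists2 z, S z & z * (1 - y * x) = 1) ->
  forall y, S y -> \tr (y * x) = 0.
Proof.
move=> Sx jx y Sy; set a := y * x; have Sa : S a by exact: SM.
have [m [g aE]] := fitting a.
(* The element [1 - g(a) a] is left invertible and annihilates [a ^+ m.+1], so [a] is nilpotent. *)
have [z _ zE] := jx (horner_mx a g * y) (SM (subalgebra_horner g Sa) Sy).
apply: (@mxtrace_nilpotent _ _ m.+1); rewrite -[LHS]mul1r -zE -mulrA mulrBl mul1r.
by rewrite -[_ * y * x]mulrA -/a -[_ * a * _]mulrA -exprS -aE subrr mulr0.
Qed.

(* The idempotent [(g(a) a)^m] given by Fitting's lemma lies in the radical of the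
   trace form; its rank vanishes in [F], hence is zero. *)
Lemma trace_jacobson x : (forall k, (0 < k <= n.+1)%N -> k%:R != 0 :> F) -> S x ->
    (forall y, S y -> \tr (y * x) = 0) ->
  forall y, S y -> exists2 z, S z & z * (1 - y * x) = 1.
Proof.
move=> F_large Sx tx y Sy; set a := y * x; have Sa : S a by exact: SM.
have [m [g aE]] := fitting a; pose b := horner_mx a g.
have ab : GRing.comm b a.
  by rewrite /b /GRing.comm -{2 3}(horner_mx_X a) -!rmorphM mulrC.
have abm k : a ^+ m.+1 * (b * a) ^+ k = a ^+ m.+1.
  elim: k => [|k IHk]; first by rewrite mulr1.
  rewrite [(b * a) ^+ _]exprSr [LHS]mulrA IHk mulrA -(commrX m.+1 ab) -mulrA -exprSr.
  by rewrite /b -aE.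
pose e := (b * a) ^+ m.+1; have eE : e = b ^+ m.+1 * a ^+ m.+1 by rewrite /e exprMn_comm.
have ee : e *m e = e by rewrite -[e *m e]/(e * e) {1}eE -mulrA abm -eE.
have Sb : S b by exact: subalgebra_horner.
have te : \tr e = 0.
  rewrite eE [a ^+ _]exprSr mulrA {2}/a mulrA; apply: tx; apply: SM => //.
  by apply: SM; apply: subalgebra_exp.
have e0 : e = 0.
  apply/eqP; rewrite -mxrank_eq0; apply: contraT; rewrite -lt0n => rk_gt0.
  have := F_large (\rank e); rewrite rk_gt0 rank_leq_row => /(_ isT).
  by rewrite -mxtrace_idempotent // te eqxx.
have am0 : a ^+ m.+1 = 0 by rewrite -(abm m.+1) -/e e0 mulr0.
(* As [a] is nilpotent, the geometric series inverts [1 - a]. *)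
exists (\sum_(k < m.+1) a ^+ k).
  elim: m.+1 => [|k IH]; first by rewrite big_ord0 -(scale0r 1); apply: SZ.
  by rewrite big_ord_recr; apply: SD => //; apply: subalgebra_exp.
have comm : GRing.comm (\sum_(k < m.+1) a ^+ k) (1 - a).
  apply: commrB; first exact: commr1.
  by apply: commr_sym; apply: commr_sum => k _; apply: commrX.
by rewrite comm -[1 - a]opprB mulNr -subrX1 am0 sub0r opprK.
Qed.

End Radical.
End MatrixAlgebra.

(** Size 0 is split off because the ring structure used above is on matrices of successor size. *)
Lemma jacobson_traceP (F : fieldType) n (S : 'M[F]_n -> Prop) (x : 'M[F]_n) :
    S 1%:M -> (forall x y, S x -> S y -> S (x + y)) ->
    (forall c x, S x -> S (c *: x)) -> (forall x y, S x -> S y -> S (x *m y)) ->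
    (forall k, (0 < k <= n)%N -> k%:R != 0 :> F) -> S x ->
  (forall y, S y -> exists2 z, S z & z *m (1%:M - y *m x) = 1%:M) <->
  (forall y, S y -> \tr (y *m x) = 0).
Proof.
case: n S x => [|n] S x S1 SD SZ SM F_large Sx.
  split=> [_ y _|_ y _]; first by rewrite /mxtrace big_ord0.
  by exists 1%:M => //; rewrite [LHS]flatmx0 [RHS]flatmx0.
split; first exact: jacobson_trace.
exact: trace_jacobson.
Qed.

(** * The regular representation and its discriminant *)

Section RegularRepresentation.
Variables (R : comNzRingType) (n : nat) (delta : R).
Implicit Types (d : bdiag n) (x y : {ffun bdiag n -> R}).

(** Row [i] expands the product of the [i]-th diagram by [d]. On row vectors, right multiplication
    gives a homomorphism. *)
Definition brauer_mx d : 'M[R]_#|{: bdiag n}| :=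
  \matrix_(i, j) ((Defs.comp (enum_val i) d == enum_val j)%:R
                  * delta ^+ loops (enum_val i) d).

Lemma brauer_mxE d i j :
  brauer_mx d i j = (Defs.comp (enum_val i) d == enum_val j)%:R
                    * delta ^+ loops (enum_val i) d.
Proof. exact: mxE. Qed.

Lemma brauer_mxM d1 d2 :
  brauer_mx d1 *m brauer_mx d2 = delta ^+ loops d1 d2 *: brauer_mx (Defs.comp d1 d2).
Proof.
apply/matrixP => i k; rewrite mxE [RHS]mxE [in RHS]brauer_mxE; set di := enum_val i.
rewrite (bigD1 (enum_rank (Defs.comp di d1))) //= !brauer_mxE enum_rankK eqxx mul1r.
rewrite big1 ?addr0 => [|j jP]; last first.
  rewrite !brauer_mxE -/di (_ : (_ == _) = false) ?mul0r //.
  by apply: contraNF jP => /eqP->; rewrite enum_valK.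
have [<- lE] := comp_loops_assoc di d1 d2.
by rewrite mulrCA -exprD addnC lE addnC exprD mulrCA.
Qed.

Lemma brauer_mx1 : brauer_mx (id_diag n) = 1%:M.
Proof.
apply/matrixP => i j; rewrite brauer_mxE [RHS]mxE.
have [-> ->] := comp_loops_1r (enum_val i).
by rewrite (inj_eq enum_val_inj) mulr1.
Qed.

Definition regular_mx x : 'M[R]_#|{: bdiag n}| := \sum_d x d *: brauer_mx d.

Lemma regular_mxE x i j : regular_mx x i j = \sum_d x d * brauer_mx d i j.
Proof. by rewrite summxE; apply: eq_bigr => d _; exact: mxE. Qed.

Lemma regular_mxD x y : regular_mx (x + y) = regular_mx x + regular_mx y.
Proof. by rewrite -big_split; apply: eq_bigr => d _; rewrite ffunE scalerDl. Qed.

Lemma regular_mxN x : regular_mx (- x) = - regular_mx x.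
Proof. by rewrite -sumrN; apply: eq_bigr => d _; rewrite ffunE scaleNr. Qed.

Lemma regular_mxZ c x : regular_mx [ffun d => c * x d] = c *: regular_mx x.
Proof. by rewrite scaler_sumr; apply: eq_bigr => d _; rewrite ffunE scalerA. Qed.

(** The row of the identity diagram holds the coefficients of [1 * x], which makes the
    representation faithful. *)
Lemma regular_mx_id x j : regular_mx x (enum_rank (id_diag n)) j = x (enum_val j).
Proof.
rewrite regular_mxE (bigD1 (enum_val j)) //= brauer_mxE enum_rankK.
have [-> ->] := comp_loops_1l (enum_val j); rewrite eqxx !mulr1 big1 ?addr0 // => d dj.
rewrite brauer_mxE enum_rankK; have [-> _] := comp_loops_1l d.
by rewrite (negbTE dj) mul0r mulr0.
Qed.

Lemma regular_mx_inj : injective regular_mx.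
Proof.
move=> x y xy; apply/ffunP => d; rewrite -(enum_rankK d).
by rewrite -!regular_mx_id xy.
Qed.

Lemma regular_mx1 : regular_mx (bone R n) = 1%:M.
Proof.
rewrite /regular_mx (bigD1 (id_diag n)) //= ffunE eqxx scale1r brauer_mx1.
rewrite big1 ?addr0 // => d dP.
by rewrite ffunE -[id_fun n]/(val (id_diag n)) val_eqE (negbTE dP) scale0r.
Qed.

Lemma regular_mxM x y :
  regular_mx (bmul delta x y) = regular_mx x *m regular_mx y.
Proof.
pose c d1 d2 d := if Defs.comp d1 d2 == d then x d1 * y d2 * delta ^+ loops d1 d2 else 0.
transitivity (\sum_d \sum_d1 \sum_d2 c d1 d2 d *: brauer_mx d).
  apply: eq_bigr => d _; rewrite [bmul _ _ _ _]ffunE scaler_suml.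
  by apply: eq_bigr => d1 _; rewrite scaler_suml.
rewrite exchange_big mulmx_suml; apply: eq_bigr => d1 _.
rewrite exchange_big mulmx_sumr; apply: eq_bigr => d2 _ /=.
rewrite -scalemxAl -scalemxAr brauer_mxM !scalerA /c.
rewrite (bigD1 (Defs.comp d1 d2)) //= eqxx big1 ?addr0 // => d.
by rewrite eq_sym => /negbTE->; rewrite scale0r.
Qed.

Section Subalgebra.
Variable P : pred (bdiag n).

Lemma inAP x : reflect (forall d, ~~ P d -> x d = 0) (inA P x).
Proof.
apply: (iffP forallP) => [h d|h d]; last first.
  by apply/implyP; apply: contraNT => /h->.
by move/implyP: (h d) => /contraNN h' /h'; rewrite negbK => /eqP.
Qed.

Lemma inA_diag d : P d -> inA P [ffun d' => (d' == d)%:R : R].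
Proof.
by move=> Pd; apply/inAP => d' nP; rewrite ffunE; case: eqP nP => // ->; rewrite Pd.
Qed.

Lemma inA_add x y : inA P x -> inA P y -> inA P (x + y).
Proof. by move=> /inAP Px /inAP Py; apply/inAP => d nP; rewrite ffunE Px ?Py ?addr0. Qed.

Lemma inA_scale c x : inA P x -> inA P [ffun d => c * x d].
Proof. by move=> /inAP Px; apply/inAP => d nP; rewrite ffunE Px ?mulr0. Qed.

Lemma inA_one : P (id_diag n) -> inA P (bone R n).
Proof.
move=> P1; apply/inAP => d nP; rewrite ffunE; case: eqP => // dE.
by move: nP; rewrite (_ : d = id_diag n) ?P1 //; apply: val_inj.
Qed.

Lemma inA_mul x y : (forall d1 d2, P d1 -> P d2 -> P (Defs.comp d1 d2)) ->
  inA P x -> inA P y -> inA P (bmul delta x y).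
Proof.
move=> PM /inAP Px /inAP Py; apply/inAP => d nP; rewrite ffunE.
rewrite big1 // => d1 _; rewrite big1 // => d2 _; case: eqP => // dE.
have [P1|/Px->] := boolP (P d1); last by rewrite !mul0r.
have [P2|/Py->] := boolP (P d2); last by rewrite mulr0 mul0r.
by rewrite -dE PM in nP.
Qed.

Lemma regular_mx_inA x : inA P x ->
  regular_mx x = \sum_(i < #|P|) x (enum_val i) *: brauer_mx (enum_val i).
Proof.
move=> /inAP Px; rewrite -(big_enum_val (fun d => x d *: brauer_mx d)).
rewrite [RHS]big_mkcond; apply: eq_bigr => d _; rewrite unfold_in.
by have [//|/Px->] := ifPn; rewrite scale0r.
Qed.

(** The trace is taken on the whole Brauer algebra even when [P] selects a subalgebra; a faithful
    representation suffices for the criterion. *)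
Definition gram_mx : 'M[R]_#|P| :=
  \matrix_(i, j) \tr (brauer_mx (enum_val i) *m brauer_mx (enum_val j)).

Definition coords x : 'rV[R]_#|P| := \row_i x (enum_val i).

Lemma coords_inj x : inA P x -> coords x = 0 -> x = 0.
Proof.
move=> /inAP Px /rowP x0; apply/ffunP => d; rewrite ffunE.
have [Pd|/Px //] := boolP (P d); have := x0 (enum_rank_in Pd d).
by rewrite !mxE enum_rankK_in.
Qed.

Lemma coords_surj (v : 'rV[R]_#|P|) : exists2 x, inA P x & coords x = v.
Proof.
exists [ffun d => \sum_i v 0 i * (d == enum_val i)%:R].
  apply/inAP => d nP; rewrite ffunE big1 // => i _.
  case: eqP => [dE|]; last by rewrite mulr0.
  by have := enum_valP i; rewrite unfold_in -dE (negbTE nP).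
apply/rowP => i; rewrite !mxE ffunE (bigD1 i) //= eqxx mulr1 big1 ?addr0 // => j ji.
by rewrite (inj_eq enum_val_inj) eq_sym (negbTE ji) mulr0.
Qed.

Lemma mxtrace_regular_mx x y : inA P x -> inA P y ->
  \tr (regular_mx y *m regular_mx x) =
    \sum_j y (enum_val j) * (coords x *m gram_mx) 0 j.
Proof.
move=> Px Py; rewrite mxtrace_mulC !regular_mx_inA // mulmx_sumr linear_sum.
apply: eq_bigr => j _; rewrite -scalemxAr linearZ /=; congr (_ * _).
rewrite mulmx_suml linear_sum mxE; apply: eq_bigr => i _.
by rewrite -scalemxAl linearZ !mxE.
Qed.

End Subalgebra.
End RegularRepresentation.

(** * The discriminant of the trace form as a test for semisimplicity *)

Lemma trace_form_nondegenerate (F : fieldType) n (delta : F) (P : pred (bdiag n)) :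
  (forall x, inA P x ->
     (forall y, inA P y -> \tr (regular_mx delta y *m regular_mx delta x) = 0) ->
   x = 0) <-> \det (gram_mx delta P) != 0.
Proof.
split=> [nd|dP x Px tx].
  (* Left kernel vectors of the Gram matrix are the coordinate rows of elements in the radical of
     the trace form. *)
  apply/negP => /det0P[v v0 vG]; have [x Px xv] := coords_surj v.
  case/eqP: v0; rewrite -xv (nd x Px) => [|y Py].
    by apply/rowP => i; rewrite !mxE ffunE.
  by rewrite (mxtrace_regular_mx delta Px Py) xv vG big1 // => j _; rewrite mxE mulr0.
apply: (coords_inj Px); apply: contraNeq dP => x0; apply/det0P.
exists (coords P x) => //; apply/rowP => j; rewrite [RHS]mxE.
have Pj : P (enum_val j) by have := enum_valP j.
rewrite -[RHS](tx _ (inA_diag F Pj)) (mxtrace_regular_mx delta Px (inA_diag F Pj)).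
rewrite (bigD1 j) //= ffunE eqxx mul1r big1 ?addr0 // => i ij.
by rewrite ffunE (inj_eq enum_val_inj) (negbTE ij) mul0r.
Qed.

Lemma semisimple_gram (F : fieldType) n (delta : F) (P : pred (bdiag n)) :
    P (id_diag n) -> (forall d1 d2, P d1 -> P d2 -> P (Defs.comp d1 d2)) ->
    (forall k, (0 < k <= #|{: bdiag n}|)%N -> k%:R != 0 :> F) ->
  semisimple_diag delta P <-> \det (gram_mx delta P) != 0.
Proof.
move=> P1 PM F_large; rewrite -trace_form_nondegenerate.
pose S (A : 'M[F]_#|{: bdiag n}|) := exists2 x, inA P x & A = regular_mx delta x.
have Sreg x : inA P x -> S (regular_mx delta x) by exists x.
have jP x : inA P x -> in_jacobson delta P x <->
    (forall y, inA P y -> \tr (regular_mx delta y *m regular_mx delta x) = 0).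
  move=> Px; have [] := @jacobson_traceP F _ S (regular_mx delta x).
  - by exists (bone F n); [exact: inA_one|rewrite regular_mx1].
  - by move=> _ _ [y Py ->] [z Pz ->]; rewrite -regular_mxD; apply/Sreg/inA_add.
  - by move=> c _ [y Py ->]; rewrite -regular_mxZ; apply/Sreg/inA_scale.
  - by move=> _ _ [y Py ->] [z Pz ->]; rewrite -regular_mxM; apply/Sreg/inA_mul.
  - exact: F_large.
  - exact: Sreg.
  move=> jt tj; split=> [[_ jx] y Py|tx].
    apply: jt (Sreg _ Py) => _ [w Pw ->]; have [z [Pz zE]] := jx w Pw.
    exists (regular_mx delta z); first exact: Sreg.
    rewrite -(regular_mx1 n delta) -regular_mxM -regular_mxN -regular_mxD.
    by rewrite -regular_mxM zE.
  (* The left inverse found among matrices lies in the image of the algebra, so it lifts, and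
     injectivity transports the identity back. *)
  split=> // y Py; have [|_ [z Pz ->] zE] := tj _ _ (Sreg _ Py).
    by move=> _ [w Pw ->]; apply: tx.
  exists z; split=> //; apply: (@regular_mx_inj _ _ delta).
  by rewrite !regular_mxM regular_mxD regular_mxN regular_mxM regular_mx1.
split=> ss x; first by move=> Px tx; apply: ss; apply/jP.
by move=> jx; have [Px _] := jx; apply: ss => //; apply/jP.
Qed.

(** The entries are built from 0, 1 and powers of [delta] by ring operations, so one integral matrix
    serves all fields. *)
Lemma map_gram_mx (R R' : comNzRingType) (f : {rmorphism R -> R'}) n (delta : R)
    (P : pred (bdiag n)) :
  gram_mx (f delta) P = map_mx f (gram_mx delta P).
Proof.
have mapE d : brauer_mx (f delta) d = map_mx f (brauer_mx delta d).
  by apply/matrixP => i j; rewrite [RHS]mxE !brauer_mxE rmorphM rmorph_nat rmorphXn.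
by apply/matrixP => i j; rewrite !mxE !mapE -map_mxM trace_map_mx.
Qed.

Lemma semisimple_disc (F : fieldType) n (delta : int) (P : pred (bdiag n)) :
    P (id_diag n) -> (forall d1 d2, P d1 -> P d2 -> P (Defs.comp d1 d2)) ->
    (forall k, (0 < k <= #|{: bdiag n}|)%N -> k%:R != 0 :> F) ->
  semisimple_diag (delta%:~R : F) P <-> (\det (gram_mx delta P))%:~R != 0 :> F.
Proof.
move=> P1 PM F_large; rewrite (semisimple_gram _ P1 PM F_large).
by rewrite (map_gram_mx intr) det_map_mx.
Qed.

(** * Comparison of characteristic 0 with large primes *)

Lemma Fp_intr_eq0 p (z : int) : prime p -> (z%:~R == 0 :> 'F_p) = (p %| `|z|)%N.
Proof.
move=> p_pr; rewrite (dvdn_pcharf (pchar_Fp p_pr)).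
by case: (intP z) => [|m|m]; rewrite ?abszN //= rmorphN oppr_eq0.
Qed.

Lemma semisimple_char0_iff_infinitely_many_primes (K : fieldType) n (delta : int)
    (P : pred (bdiag n)) : [pchar K] =i pred0 ->
    P (id_diag n) -> (forall d1 d2, P d1 -> P d2 -> P (Defs.comp d1 d2)) ->
  semisimple_diag (delta%:~R : K) P <->
  (forall N : nat, exists p : nat, [/\ (N < p)%N, prime p &
     semisimple_diag (delta%:~R : 'F_p) P]).
Proof.
move=> charK P1 PM; set D := \det (gram_mx delta P).
have natK := (pcharf0P K).1 charK.
have intK (z : int) : (z%:~R == 0 :> K) = (z == 0).
  by case: z => m; rewrite ?NegzE ?mulrNz ?oppr_eq0 -pmulrn natK.
have ssK : semisimple_diag (delta%:~R : K) P <-> D != 0.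
  rewrite semisimple_disc //; last by move=> k; rewrite natK lt0n => /andP[].
  by rewrite intK.
have ssF p : prime p -> (#|{: bdiag n}| < p)%N ->
    semisimple_diag (delta%:~R : 'F_p) P <-> D%:~R != 0 :> 'F_p.
  move=> p_pr lt_p; apply: semisimple_disc => // k /andP[k0 kn].
  rewrite -(dvdn_pcharf (pchar_Fp p_pr)); apply: contraTN lt_p => /(dvdn_leq k0); lia.
rewrite ssK; split=> [D0 N|h].
  (* The three summands ensure the required bound, the validity of the criterion over ['F_p], and
     that [p] cannot divide the nonzero integer [D]. *)
  have [p lt_p p_pr] := prime_above (N + #|{: bdiag n}| + `|D|).
  exists p; split=> //; first by lia.
  apply/ssF => //; first by lia.
  rewrite Fp_intr_eq0 //; apply/negP => /dvdn_leq; lia.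
(* A single prime above the number of diagrams is enough: if [D] is nonzero modulo it, then [D] is
   nonzero. *)
have [p [lt_p p_pr /ssF]] := h #|{: bdiag n}|.
by move=> /(_ p_pr lt_p); apply: contraNneq => ->.
Qed.

Theorem theoremA3 (K : fieldType) (charK0 : [pchar K] =i pred0) (delta : int) :
  (forall r s : nat, (0 < r + s)%N ->
     (walled_brauer_semisimple r s (delta%:~R : K) <->
      (forall N : nat, exists p : nat, [/\ (N < p)%N, prime p &
          walled_brauer_semisimple r s (delta%:~R : 'F_p)])))
  /\
  (forall d : nat, (0 < d)%N ->
     (brauer_semisimple d (delta%:~R : K) <->
      (forall N : nat, exists p : nat, [/\ (N < p)%N, prime p &
          brauer_semisimple d (delta%:~R : 'F_p)]))).
Proof.
split=> [r s _|d _]; apply: semisimple_char0_iff_infinitely_many_primes => //.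
- exact: walled_id.
- exact: walled_comp.
Qed.
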